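(* Let $n\ge 1$, let $\pi\in\mathtt{NC}(n)$, and let $\sigma=\sigma(\pi)$ be the $312$-avoiding permutation of $\{1,\ldots,n\}$ attached to $\pi$ by the construction $\pi\mapsto d(\pi)\mapsto\mu\mapsto\sigma$ described in the context. Then $$\mathrm{maj}(\pi)=\mathrm{maj}(\sigma)+\mathrm{maj}(\sigma^{-1}).$$
   Context: $\mathtt{NC}(n)$ is the set of non-crossing partitions of $\{1,\ldots,n\}$, i.e. set partitions such that whenever $a<b<c<d$, $a,c$ lie in a block $B_1$ and $b,d$ lie in a block $B_2$, one has $B_1=B_2$. For a block $B=\{j_1<\cdots<j_p\}$ put $\mathrm{wt}(B):=0$ if $p=1$ and $\mathrm{wt}(B):=j_1+j_p+2\sum_{k=2}^{p-1}j_k-p+1$ otherwise. For $\pi$ with blocks $B_1,\ldots,B_m$, $\mathrm{maj}(\pi):=\sum_{i=1}^m\mathrm{wt}(B_i)$. For a permutation $\sigma=\sigma_1\cdots\sigma_n$, $\mathrm{maj}(\sigma)$ is the sum of all $1\le j\le n-1$ with $\sigma_j>\sigma_{j+1}$. Construction of $\sigma$ from $\pi$ (with blocks $B_1,\ldots,B_m$): 1. Let $i_1<\cdots<i_m$ be the increasing rearrangement of $\{\min B_k\}$ and $j_1<\cdots<j_m$ that of $\{\max B_k\}$. A Dyck path of size $n$ is a word in $\{0,1\}$ with $n$ letters $0$ (up) and $n$ letters $1$ (right) in which every prefix contains at least as many $0$'s as $1$'s. A peak (resp. valley) at position $i$ means that the $i$-th letter is $0$ and the $(i+1)$-st is $1$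 (resp. the $i$-th is $1$ and the $(i+1)$-st is $0$). Let $d(\pi)=d_1\cdots d_{2n}$ be the Dyck path of size $n$ whose set of peak positions is $\{i_k+j_k-1:1\le k\le m\}$ and whose set of valley positions is $\{i_{k+1}+j_k-1:1\le k\le m-1\}$. 2. Let $l_i$ be the position of the $i$-th $0$ from the left in $d(\pi)$, and $a_i:=\#\{j<l_{n+1-i}: d_j=1\}$ for $1\le i\le n$. Let $\mu$ be the permutation of $\{1,\ldots,n\}$ with Lehmer code $(a_1,\ldots,a_n)$, i.e. $a_i=\#\{j>i:\mu_j<\mu_i\}$. 3. Let $\sigma:=\overline{\mu^{-1}}$, where for a permutation $\tau=\tau_1\cdots\tau_n$ one sets $\overline{\tau}:=\overline{\tau_1}\cdots\overline{\tau_n}$ with $\overline{\tau_i}:=n+1-\tau_i$. *)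

(* Defs.v *)
From mathcomp Require Import all_boot all_order all_fingroup.

Set Implicit Arguments.
Unset Strict Implicit.
Unset Printing Implicit Defensive.

(* The ground set {1, ..., n} is 'I_n, with i : 'I_n standing for the integer
   i + 1; all values, positions, minima and maxima below are converted back
   to the 1-based convention.  Sequences are read 1-based through [at1]. *)

Definition at1 (s : seq nat) (k : nat) : nat := nth 0 s k.-1.

Definition noncrossing n (pi : {set {set 'I_n}}) : Prop :=
  forall (B1 B2 : {set 'I_n}) (a b c d : 'I_n),
    B1 \in pi -> B2 \in pi -> a < b -> b < c -> c < d ->
    a \in B1 -> c \in B1 -> b \in B2 -> d \in B2 -> B1 = B2.

Definition is_NC n (pi : {set {set 'I_n}}) : Prop :=
  partition pi [set: 'I_n] /\ noncrossing pi.

(* j_1 < ... < j_p: [enum] lists a set of ordinals in increasing order. *)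
Definition elems n (B : {set 'I_n}) : seq nat :=
  [seq (val i).+1 | i <- enum B].

(* The subtraction is not truncated, since p <= j_p. *)
Definition wt n (B : {set 'I_n}) : nat :=
  let j := at1 (elems B) in
  let p := #|B| in
  if p == 1 then 0
  else j 1 + j p + 2 * (\sum_(2 <= k < p) j k) - p + 1.

Definition maj_part n (pi : {set {set 'I_n}}) : nat := \sum_(B in pi) wt B.

Definition block_min n (B : {set 'I_n}) : nat := head 0 (elems B).
Definition block_max n (B : {set 'I_n}) : nat := last 0 (elems B).

Definition minima n (pi : {set {set 'I_n}}) : seq nat :=
  sort leq [seq block_min B | B <- enum pi].
Definition maxima n (pi : {set {set 'I_n}}) : seq nat :=
  sort leq [seq block_max B | B <- enum pi].

(* Lattice words: [false] is the letter 0 (up), [true] the letter 1 (right). *)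

Definition letter (d : seq bool) (i : nat) : bool := nth false d i.-1.

Definition is_dyck (n : nat) (d : seq bool) : bool :=
  [&& count_mem false d == n, count_mem true d == n &
      all (fun k => count_mem true (take k d) <= count_mem false (take k d))
          (iota 0 (size d).+1)].

Definition peaks (d : seq bool) : seq nat :=
  [seq i <- iota 1 (size d).-1 | ~~ letter d i && letter d i.+1].
Definition valleys (d : seq bool) : seq nat :=
  [seq i <- iota 1 (size d).-1 | letter d i && ~~ letter d i.+1].

Definition peak_positions n (pi : {set {set 'I_n}}) : seq nat :=
  [seq at1 (minima pi) k + at1 (maxima pi) k - 1 | k <- iota 1 #|pi|].
Definition valley_positions n (pi : {set {set 'I_n}}) : seq nat :=
  [seq at1 (minima pi) k.+1 + at1 (maxima pi) k - 1 | k <- iota 1 #|pi|.-1].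

Definition same_set (s t : seq nat) : bool :=
  all (fun x => x \in t) s && all (fun x => x \in s) t.

Definition is_dyck_of n (pi : {set {set 'I_n}}) (d : seq bool) : bool :=
  [&& is_dyck n d, same_set (peaks d) (peak_positions pi) &
      same_set (valleys d) (valley_positions pi)].

(* Definite description: when pi is a non-crossing partition, exactly one
   word satisfies [is_dyck_of pi]; the default value is then irrelevant. *)
Definition dyck_of n (pi : {set {set 'I_n}}) : seq bool :=
  odflt (nseq_tuple n.*2 false)
        [pick d : n.*2.-tuple bool | is_dyck_of pi d].

Definition zero_positions (d : seq bool) : seq nat :=
  [seq p <- iota 1 (size d) | ~~ letter d p].

(* code_of_path n d i is a_i, for 1 <= i <= n. *)
Definition code_of_path (n : nat) (d : seq bool) (i : nat) : nat :=
  let l := at1 (zero_positions d) in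
  count (letter d) (iota 1 (l (n + 1 - i)).-1).

Definition lehmer n (mu : {perm 'I_n}) (i : 'I_n) : nat :=
  #|[set j : 'I_n | (i < j) && (mu j < mu i)]|.

(* Definite description again: a_i <= n - i for every Dyck path of size n, so
   exactly one permutation has this Lehmer code. *)
Definition perm_of_code n (a : nat -> nat) : {perm 'I_n} :=
  odflt 1%g [pick mu : {perm 'I_n} | [forall i : 'I_n, lehmer mu i == a i.+1]].

Definition mu_of n (pi : {set {set 'I_n}}) : {perm 'I_n} :=
  perm_of_code n (code_of_path n (dyck_of pi)).

(* [rev_ord] is v |-> n + 1 - v in 1-based terms; in {perm _} the product
   s * t applies s first, so (bar tau) i = rev_ord (tau i). *)
Definition bar n (tau : {perm 'I_n}) : {perm 'I_n} :=
  (tau * perm (@rev_ord_inj n))%g.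

Definition sigma_of n (pi : {set {set 'I_n}}) : {perm 'I_n} :=
  bar (mu_of pi)^-1%g.

Definition word n (s : {perm 'I_n}) : seq nat :=
  [seq (val (s i)).+1 | i <- enum 'I_n].

Definition maj_perm n (s : {perm 'I_n}) : nat :=
  \sum_(1 <= j < n | at1 (word s) j > at1 (word s) j.+1) j.

(* Main.v *)
Require Import Defs.
From mathcomp Require Import all_boot all_order all_fingroup.
From mathcomp Require Import zify.

Set Implicit Arguments.
Unset Strict Implicit.
Unset Printing Implicit Defensive.

(** Write i_1 < ... < i_m for the sorted block minima of pi and
    j_1 < ... < j_m for the sorted block maxima.  Both sides of the identity
    equal n ^ 2 + m - (i_1 + ... + i_m) - (j_1 + ... + j_m).

    For maj(pi), the formula wt(B) = 2 * (sum of B) - min B - max B - |B| + 1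
    holds for singletons too, and the blocks partition {1, ..., n}
    ([wt_sum], [maj_part_eq]).

    For the permutations, the peak and valley positions say that the k-th run
    of up steps of d(pi) ends with the j_k-th up step and is preceded by
    i_k - 1 right steps.  Thus the t-th up step of d(pi) is preceded by
    c(t) := i_k - 1 right steps, where j_(k-1) < t <= j_k.  This function c is
    nondecreasing, it increases after t exactly when t is a block maximum other
    than n, and its values are the numbers i_k - 1 ([rise_jump],
    [rise_imageP]).  The path exists because c(t) < t: the blocks with maximum
    below t have minimum at most t, and so does the block of t
    ([ballot_blocks]).

    The Lehmer code of mu is a_i = c(n + 1 - i), a nonincreasing sequence.
    Descents of mu are strict drops of the code, so they are the n - j_k with
    k < m.  For a nonincreasing code the descents of the inverse of mu are the
    nonzero values of the code ([descents_inv_decreasing_code]), so they are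
    the i_k - 1 with k > 1.  Since sigma is the complement of the inverse of mu
    and the inverse of sigma is the reversal of mu, the descents of sigma are
    the j < n such that j + 1 is not a block minimum, and those of its inverse
    are the j < n that are not block maxima ([maj_sigma], [maj_sigma_inv]).
    Summing complements in {1, ..., n} gives the common value. *)

(** * Lehmer codes *)

Lemma card_ltn_ord n k : k <= n -> #|[set x : 'I_n | x < k]| = k.
Proof.
move=> le_kn; have -> : [set x : 'I_n | x < k] = widen_ord le_kn @: [set: 'I_k].
  apply/setP=> x; rewrite inE; apply/idP/imsetP => [lt_xk|[y _ ->]] /=.
    by exists (Ordinal lt_xk); rewrite ?inE //; apply: val_inj.
  exact: ltn_ord.
rewrite card_imset ?cardsT ?card_ord // => x y /(congr1 val) /= eq_xy.
exact: val_inj.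
Qed.

Lemma card_perm_ltn n (mu : {perm 'I_n}) k : k <= n ->
  #|[set j | mu j < k]| = k.
Proof.
move=> le_kn; rewrite -[RHS](card_ltn_ord le_kn).
rewrite -(card_preimset [set x : 'I_n | x < k] (@perm_inj _ mu)).
by apply: eq_card => j; rewrite !inE.
Qed.

Lemma lehmer_le_val n (mu : {perm 'I_n}) i : lehmer mu i <= mu i.
Proof.
rewrite -[leqRHS](card_perm_ltn mu (ltnW (ltn_ord (mu i)))).
by apply/subset_leq_card/subsetP => j; rewrite !inE => /andP[].
Qed.

Lemma lehmer_drop n (mu : {perm 'I_n}) (i j : 'I_n) : j = i.+1 :> nat ->
  (lehmer mu j < lehmer mu i) = (mu j < mu i).
Proof.
move=> ji; case: (ltnP (mu j) (mu i)) => [mu_ji|mu_ij]; last first.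
  apply/negbTE; rewrite -leqNgt; apply/subset_leq_card/subsetP => k.
  rewrite !inE => /andP[ik ki].
  have kj : k != j by apply: contraTneq ki => ->; rewrite -leqNgt.
  have : (k : nat) != j by [].
  lia.
apply: proper_card; apply/properP; split.
  by apply/subsetP => k; rewrite !inE; lia.
by exists j; rewrite !inE; lia.
Qed.

(** Induction on n: [lift_perm ord0 k] prescribes the first value k and leaves
    all comparisons between the later values unchanged. *)
Lemma lehmer_surj n (a : nat -> nat) : (forall i, i < n -> a i + i < n) ->
  exists mu : {perm 'I_n}, forall i : 'I_n, lehmer mu i = a i.
Proof.
elim: n a => [|n IHn] a a_lt; first by exists 1%g; case.
have [i lt_in|mu mu_a] := IHn (fun i => a i.+1).
  by have := a_lt i.+1; lia.
have a0_lt : a 0 < n.+1 by have := a_lt 0; lia.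
pose k := Ordinal a0_lt; exists (lift_perm ord0 k mu) => i.
case: (unliftP ord0 i) => [j|] ->; rewrite /lehmer.
  rewrite lift_perm_lift -[a _]mu_a /lehmer.
  rewrite -[RHS](card_imset _ (@lift_inj _ ord0)); apply: eq_card => x.
  apply/idP/imsetP => [|[y]]; rewrite !inE.
    case: (unliftP ord0 x) => [y|] -> //; rewrite lift_perm_lift /= => H.
    by exists y => //; rewrite inE; move: H; rewrite /bump /=; lia.
  by move=> H ->; rewrite lift_perm_lift /=; move: H; rewrite /bump /=; lia.
rewrite lift_perm_id -[RHS](card_perm_ltn mu (a0_lt : k <= n)).
rewrite -[RHS](card_imset _ (@lift_inj _ ord0)); apply: eq_card => x.
apply/idP/imsetP => [|[y]]; rewrite !inE.
  case: (unliftP ord0 x) => [y|] -> //; rewrite lift_perm_lift /= => H.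
  by exists y => //; rewrite !inE; move: H; rewrite /bump /=; lia.
by move=> H ->; rewrite lift_perm_lift /=; move: H; rewrite /bump /=; lia.
Qed.

Section DecreasingCode.
Variables (n : nat) (mu : {perm 'I_n}).
Hypothesis code_mono : forall i j : 'I_n, i <= j -> lehmer mu j <= lehmer mu i.

(** The content is that no value below mu i stands left of i.  Otherwise let j
    be the last position before i carrying such a value.  The value at j + 1
    is then at least mu i, so every position counted by the code at j is
    counted at j + 1, together with k; the code would increase after j. *)
Lemma code_of_inversion (i k : 'I_n) : i < k -> mu i = (mu k).+1 :> nat ->
  lehmer mu i = mu i.
Proof.
move=> lt_ik mu_ik; apply/eqP; rewrite eqn_leq lehmer_le_val leqNgt.
apply/negP => lt_code.
have [j0 j0P] : exists j : 'I_n, (j < i) && (mu j < mu i).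
  have [/existsP//|/existsPn noj] :=
    boolP [exists j : 'I_n, (j < i) && (mu j < mu i)].
  move: lt_code; rewrite ltnNge => /negP[].
  rewrite -[leqLHS](card_perm_ltn mu (ltnW (ltn_ord (mu i)))).
  apply/subset_leq_card/subsetP => j; rewrite !inE /= => mu_j.
  have := noj j; rewrite mu_j !andbT -leqNgt leq_eqVlt => /predU1P[ij|//].
  by rewrite (val_inj ij : i = j) ltnn in mu_j.
case: (@arg_maxnP _ j0 (fun j : 'I_n => (j < i) && (mu j < mu i)) val j0P).
move=> j /andP[lt_ji mu_ji] jmax.
have lt_j1 : j.+1 < n by apply: leq_ltn_trans (ltn_ord i).
pose j1 := Ordinal lt_j1.
have mu_j1 : mu i <= mu j1.
  rewrite leqNgt; apply/negP => mu_j1i.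
  have lt_j1i : j1 < i.
    rewrite ltn_neqAle [_ <= _]lt_ji andbT.
    by apply: contraTneq mu_j1i => /val_inj->; rewrite ltnn.
  by have := jmax j1; rewrite lt_j1i mu_j1i /= ltnn => /(_ isT).
have neq_jk : (mu j : nat) <> mu k.
  move=> /val_inj/perm_inj ejk; move: lt_ji lt_ik; rewrite ejk; lia.
have := @code_mono j j1 (leqnSn j); rewrite leqNgt => /negP; apply.
apply: proper_card; apply/properP; split; last first.
  by exists k; rewrite !inE /=; lia.
apply/subsetP => x; rewrite !inE /= => /andP[jx xj].
have : (x : nat) <> j.+1.
  move=> xj1; have ex : x = j1 by apply: val_inj.
  by move: xj; rewrite ex; lia.
lia.
Qed.

(** The position i is the first one with the given code v.  Earlier positions
    have codes above v, hence values above v, so the values 0, ..., v are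
    all still available at i; a code equal to v then forces the value v there,
    and v - 1 comes later. *)
Lemma inversion_of_code (i0 : 'I_n) : 0 < lehmer mu i0 ->
  exists i k : 'I_n,
    [/\ i < k, mu i = lehmer mu i0 :> nat & mu i = (mu k).+1 :> nat].
Proof.
move=> v_gt0.
case: (@arg_minnP _ i0 (fun i => lehmer mu i == lehmer mu i0) val (eqxx _)).
move=> i /eqP code_i imin.
have small_right (j : 'I_n) : mu j <= lehmer mu i0 -> i <= j.
  move=> mu_j; rewrite leqNgt; apply/negP => lt_ji.
  have le_code := code_mono (ltnW lt_ji).
  have := lehmer_le_val mu j; have := imin j.
  case: eqP => [_ /(_ isT) /=|neq _ /=]; lia.
have mu_i : mu i = lehmer mu i0 :> nat.
  apply/eqP; rewrite eqn_leq -{2}code_i lehmer_le_val andbT leqNgt.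
  apply/negP => lt_mu; suff: lehmer mu i0 < lehmer mu i by rewrite code_i ltnn.
  rewrite -[leqLHS](card_perm_ltn mu (leq_trans lt_mu (ltnW (ltn_ord (mu i))))).
  apply/subset_leq_card/subsetP => j; rewrite !inE ltnS => mu_j.
  rewrite ltn_neqAle small_right // andbT (leq_ltn_trans mu_j lt_mu) andbT.
  by apply: contraTneq mu_j => /val_inj <-; rewrite -ltnNge.
have lt_v : (mu i).-1 < n by have := ltn_ord (mu i); lia.
exists i, (mu^-1%g (Ordinal lt_v)); rewrite permKV /=; split=> //; last by lia.
rewrite ltn_neqAle small_right ?permKV /=; last by lia.
rewrite andbT; apply/negP => /eqP /val_inj ei.
by have := congr1 (fun x => val (mu x)) ei; rewrite permKV /=; lia.
Qed.

Lemma descents_inv_decreasing_code (u v : 'I_n) : v = u.+1 :> nat ->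
  (mu^-1%g v < mu^-1%g u) = [exists i, lehmer mu i == v].
Proof.
move=> vu; apply/idP/existsP => [lt_vu|[i0 /eqP code_i0]].
  exists (mu^-1%g v); apply/eqP.
  by rewrite (code_of_inversion lt_vu) ?permKV.
have [|i [k [lt_ik mu_i mu_ik]]] := @inversion_of_code i0; first by lia.
have -> : v = mu i by apply: val_inj; rewrite /= mu_i code_i0.
have -> : u = mu k by apply: val_inj => /=; lia.
by rewrite !permK.
Qed.
End DecreasingCode.

(** * Lattice words given by the positions of their up steps *)

Lemma count_iota_leq m n : count (fun t => t <= m) (iota 1 n) = minn m n.
Proof.
elim: n => [|n IHn]; first by rewrite minn0.
by rewrite -(addn1 n) iotaD count_cat IHn /=; lia.
Qed.

(** Reading from the left, the letter changes exactly after the positions that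
    are peaks or valleys. *)
Lemma word_of_turns d1 d2 : size d1 = size d2 -> letter d1 1 = letter d2 1 ->
  peaks d1 =i peaks d2 -> valleys d1 =i valleys d2 -> d1 = d2.
Proof.
move=> eq_size eq1 eqP eqV.
have eq_letter p : 0 < p <= size d1 -> letter d1 p = letter d2 p.
  elim: p => // -[//|p] IHp lt_p; have := IHp ltac:(lia).
  have := eqV p.+1; have := eqP p.+1; rewrite !mem_filter !mem_iota -eq_size.
  have -> : 1 <= p.+1 < 1 + (size d1).-1 by lia.
  by rewrite !andbT; do 4!case: (letter _ _).
apply: (@eq_from_nth _ false) => // i lt_i.
exact: (eq_letter i.+1).
Qed.

Section LatticeWord.
Variables (n : nat) (c : nat -> nat).
Hypothesis c_mono : forall s t, 0 < s -> s <= t -> t <= n -> c s <= c t.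
Hypothesis c_lt : forall t, 0 < t -> t <= n -> c t < t.

(** [c t] is the number of right steps before the t-th up step, which is
    therefore the letter number t + c t. *)
Definition zeros_at := [seq t + c t | t <- iota 1 n].
Definition lattice_word := [seq p \notin zeros_at | p <- iota 1 n.*2].

Lemma zeros_atP p :
  reflect (exists t, [/\ 0 < t, t <= n & p = t + c t]) (p \in zeros_at).
Proof.
apply: (iffP mapP) => [[t]|[t [t0 tn ->]]].
  by rewrite mem_iota => t_in ->; exists t; split=> //; lia.
by exists t; rewrite ?mem_iota //; lia.
Qed.

Lemma sorted_zeros_at : sorted ltn zeros_at.
Proof.
apply: (@homo_sorted_in _ _ (fun t => 0 < t <= n) _ ltn) (iota_ltn_sorted _ _).
  move=> s t; rewrite !unfold_in => s_in t_in lt_st.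
  by have := @c_mono s t; rewrite /=; lia.
by apply/allP => t; rewrite mem_iota; lia.
Qed.

Lemma size_lattice_word : size lattice_word = n.*2.
Proof. by rewrite size_map size_iota. Qed.

Lemma letter_lattice_word p : 0 < p <= n.*2 ->
  letter lattice_word p = (p \notin zeros_at).
Proof.
move=> p_in; rewrite /letter (nth_map 0) ?size_iota; last by lia.
by rewrite nth_iota ?add1n ?prednK //; lia.
Qed.

Lemma zero_positions_lattice_word : zero_positions lattice_word = zeros_at.
Proof.
apply: (irr_sorted_eq ltn_trans ltnn _ sorted_zeros_at).
  exact/(sorted_filter ltn_trans)/iota_ltn_sorted.
move=> p; rewrite mem_filter mem_iota size_lattice_word.
apply/andP/idP => [[+ p_in]|p_in].
  by rewrite letter_lattice_word ?negbK //; lia.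
have [t [t0 tn pt]] := zeros_atP _ p_in; have := c_lt t0 tn => ct.
by split; [rewrite letter_lattice_word ?p_in|]; lia.
Qed.

Lemma count_zeros k :
  count (mem zeros_at) (iota 1 k) = count (fun t => t + c t <= k) (iota 1 n).
Proof.
have -> : count (fun t => t + c t <= k) (iota 1 n) =
          count (fun p => p <= k) zeros_at by rewrite count_map.
rewrite -!size_filter.
apply/perm_size/uniq_perm; rewrite ?filter_uniq ?iota_uniq //.
  exact: sorted_uniq ltn_trans ltnn _ sorted_zeros_at.
move=> p; rewrite !mem_filter mem_iota /= andbC.
case: (boolP (p \in zeros_at)) => [/zeros_atP[t [t0 tn ->]]|]; rewrite ?andbF //.
lia.
Qed.

Lemma count_letter k : k <= n.*2 ->
  count (letter lattice_word) (iota 1 k) = k - count (mem zeros_at) (iota 1 k).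
Proof.
move=> le_k.
rewrite -[k in k - _](size_iota 1) -(count_predC (mem zeros_at)) addKn.
apply: eq_in_count => p; rewrite mem_iota => p_in.
by rewrite letter_lattice_word //; lia.
Qed.

Lemma code_of_lattice_word i : 0 < i <= n ->
  code_of_path n lattice_word i = c (n + 1 - i).
Proof.
move=> i_in; rewrite /code_of_path zero_positions_lattice_word.
set t := n + 1 - i; have t_in : 0 < t <= n by rewrite /t; lia.
have ct := @c_lt t; have -> : at1 zeros_at t = t + c t.
  rewrite /at1 (nth_map 0) ?size_iota ?nth_iota; try lia.
  by have -> : 1 + t.-1 = t by lia.
rewrite count_letter ?count_zeros; last by lia.
rewrite (@eq_in_count _ _ (fun s => s <= t.-1)) ?count_iota_leq; first by lia.
move=> s; rewrite mem_iota => s_in /=.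
by have := @c_mono s t; have := @c_mono t s; lia.
Qed.

Lemma is_dyck_lattice_word : is_dyck n lattice_word.
Proof.
have count_true k : k <= n.*2 ->
    count_mem true (take k lattice_word) = k - count (mem zeros_at) (iota 1 k).
  move=> le_k; rewrite -map_take take_iota (minn_idPl le_k).
  rewrite -[k in k - _](size_iota 1) -(count_predC (mem zeros_at)) addKn.
  rewrite count_map.
  by apply: eq_count => p /=; rewrite eqb_id.
have count_false k : k <= n.*2 ->
    count_mem false (take k lattice_word) = count (mem zeros_at) (iota 1 k).
  move=> le_k; rewrite -map_take take_iota (minn_idPl le_k) count_map.
  by apply: eq_count => p /=; rewrite eqbF_neg negbK.
have zeros_n : count (mem zeros_at) (iota 1 n.*2) = n.
  rewrite count_zeros -[RHS](size_iota 1) -[RHS]count_predT.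
  apply: eq_in_count => t; rewrite mem_iota => t_in.
  by have := @c_lt t; rewrite /=; lia.
have take_all : take n.*2 lattice_word = lattice_word.
  by rewrite -size_lattice_word take_size.
apply/and3P; split.
- by rewrite -take_all count_false // zeros_n.
- by rewrite -take_all count_true // zeros_n; apply/eqP; lia.
apply/allP => k; rewrite mem_iota size_lattice_word => k_in.
rewrite count_true ?count_false; try lia.
(* Since c t < t, the t-th up step is at most the letter number 2t - 1, so at
   least half of the first k letters are up steps. *)
have : count (fun t => t <= uphalf k) (iota 1 n) <=
       count (mem zeros_at) (iota 1 k).
  rewrite count_zeros -!size_filter uniq_leq_size ?filter_uniq ?iota_uniq //.
  move=> t; rewrite !mem_filter mem_iota => /andP[tk t_in].
  by have := @c_lt t; rewrite /=; lia.
by rewrite count_iota_leq; lia.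
Qed.

Lemma peaks_lattice_word p : reflect
  (exists t, [/\ 0 < t, t <= n, t < n -> c t < c t.+1 & p = t + c t])
  (p \in peaks lattice_word).
Proof.
rewrite mem_filter mem_iota size_lattice_word.
apply: (iffP idP) => [/andP[+ p_in]|[t [t0 tn ct ->]]].
  rewrite !letter_lattice_word; try lia.
  rewrite negbK => /andP[/zeros_atP[t [t0 tn ->]] /zeros_atP nz].
  exists t; split=> // lt_tn; rewrite ltnNge; apply/negP => le_c; apply: nz.
  by exists t.+1; have := @c_mono t t.+1; split; lia.
have clt := c_lt t0 tn; have p_in : 0 < t + c t < n.*2 by lia.
rewrite !letter_lattice_word; try lia.
rewrite negbK; apply/andP; split; last by lia.
apply/andP; split; first by apply/zeros_atP; exists t.
apply/zeros_atP => -[s [s0 sn es]].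
have [lt_ts|le_st] := ltnP t s; last by have := @c_mono s t; lia.
by have := @c_mono t.+1 s; lia.
Qed.

Lemma valleys_lattice_word p : reflect
  (exists t, [/\ 0 < t, t < n, c t < c t.+1 & p = t + c t.+1])
  (p \in valleys lattice_word).
Proof.
rewrite mem_filter mem_iota size_lattice_word.
apply: (iffP idP) => [/andP[+ p_in]|[t [t0 tn ct ->]]].
  rewrite !letter_lattice_word; try lia.
  rewrite negbK => /andP[/zeros_atP nz /zeros_atP[[|t] [//]]].
  move=> _ tn ep; have t0 : 0 < t by case: t ep tn => //; have := @c_lt 1; lia.
  exists t; split=> //; last by lia.
  rewrite ltnNge; apply/negP => le_c; apply: nz.
  by exists t; have := @c_mono t t.+1; split; lia.
have clt : c t.+1 < t.+1 by apply: c_lt.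
rewrite !letter_lattice_word; try lia.
rewrite negbK; apply/andP; split; last by lia.
apply/andP; split; last by apply/zeros_atP; exists t.+1; split; lia.
apply/zeros_atP => -[s [s0 sn es]].
have [lt_ts|le_st] := ltnP t s; last by have := @c_mono s t; lia.
by have := @c_mono t.+1 s; lia.
Qed.

End LatticeWord.

(** * The step function of two increasing lists *)

Lemma count_ltS t s : uniq s ->
  count (fun j => j < t.+1) s = (t \in s) + count (fun j => j < t) s.
Proof.
elim: s => //= x s IHs /andP[x_s /IHs->]; rewrite inE.
case: (eqVneq t x) => [->|neq_tx] /=; first by rewrite (negbTE x_s); lia.
by rewrite ltnS leq_eqVlt eq_sym (negbTE neq_tx) /=; lia.
Qed.

(** For the minima I and maxima J this is i_k - 1 where j_(k-1) < t <= j_k; the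
    number of maxima below t is the 0-based index of that i_k. *)
Definition rise (I J : seq nat) (t : nat) : nat :=
  (nth 0 I (count (fun j => j < t) J)).-1.

Section Rise.
Variables (n : nat) (I J : seq nat).
Hypothesis (I_sorted : sorted ltn I) (J_sorted : sorted ltn J).
Hypothesis eq_size : size I = size J.
Hypothesis (I_in : {in I, forall i, 0 < i <= n}).
Hypothesis (J_in : {in J, forall j, 0 < j <= n}).
Hypothesis n_in_J : n \in J.
(* The t-th up step is preceded by fewer than t right steps; this is the form
   in which block minima and maxima provide it. *)
Hypothesis ballot : forall t, 0 < t -> t <= n ->
  count (fun j => j < t) J < count (fun i => i <= t) I.

Lemma count_J_lt t : t <= n -> count (fun j => j < t) J < size I.
Proof.
move=> le_tn; rewrite eq_size ltn_neqAle count_size andbT -all_count.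
by apply/allPn; exists n => //; rewrite -leqNgt.
Qed.

Lemma nth_I_lt k l : k < l -> l < size I -> nth 0 I k < nth 0 I l.
Proof.
move=> lt_kl lt_l; apply: sorted_ltn_nth ltn_trans _ _ I_sorted _ _ _ _ _ => //.
exact: ltn_trans lt_l.
Qed.

Lemma rise_mono s t : 0 < s -> s <= t -> t <= n -> rise I J s <= rise I J t.
Proof.
move=> _ le_st le_tn; rewrite /rise.
set k := count _ _; set l := count _ _.
have : k <= l by apply: sub_count => j /= lt_js; apply: leq_trans le_st.
rewrite leq_eqVlt => /predU1P[->//|lt_kl].
by rewrite -!subn1 leq_sub2r // ltnW // nth_I_lt // count_J_lt.
Qed.

Lemma rise_lt t : 0 < t -> t <= n -> rise I J t < t.
Proof.
move=> t0 le_tn; rewrite /rise.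
have le_I : sorted <=%O I by apply: sub_sorted I_sorted => x y; apply: ltnW.
have := Order.POrderTheory.nth_count_le 0 le_I (ballot t0 le_tn).
by rewrite leEnat; case: (nth _ _ _).
Qed.

Lemma rise_jump t : 0 < t -> t < n -> (rise I J t < rise I J t.+1) = (t \in J).
Proof.
move=> t0 lt_tn; rewrite /rise count_ltS ?(sorted_uniq ltn_trans ltnn) //.
case: (boolP (t \in J)) => [tJ|_]; last by rewrite ltnn.
have lt_k := count_J_lt lt_tn.
rewrite count_ltS ?(sorted_uniq ltn_trans ltnn) // tJ in lt_k.
rewrite -[nat_of_bool true]/1 add1n in lt_k *.
have := nth_I_lt (ltnSn _) lt_k; have := I_in (mem_nth 0 (ltnW lt_k)).
case: (nth _ _ _) => // i _; lia.
Qed.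

Lemma rise_at_J k : k < size J -> rise I J (nth 0 J k) = (nth 0 I k).-1.
Proof.
move=> lt_k; rewrite /rise.
by have -> := Order.POrderTheory.count_lt_nth 0 J_sorted lt_k.
Qed.

Lemma rise_after_J k : k < size J ->
  rise I J (nth 0 J k).+1 = (nth 0 I k.+1).-1.
Proof.
move=> lt_k; rewrite /rise.
by have -> := Order.POrderTheory.count_le_nth 0 J_sorted lt_k.
Qed.

Lemma last_J k : k < size J -> (nth 0 J k == n) = (k.+1 == size J).
Proof.
have lt_i : index n J < size J by rewrite index_mem.
have i_last : index n J = (size J).-1.
  apply/eqP; rewrite eqn_leq -ltnS (ltn_predK lt_i) lt_i leqNgt /=.
  apply/negP => lt_l.
  have lt_s : (size J).-1 < size J by rewrite (ltn_predK lt_i).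
  have := sorted_ltn_nth ltn_trans 0 J_sorted (index n J) _ lt_i lt_s lt_l.
  by rewrite nth_index //; case/andP: (J_in (mem_nth 0 lt_s)) => _; case: leqP.
move=> lt_k; rewrite -[X in _ == X](nth_index 0 n_in_J) nth_uniq //; last first.
  exact: sorted_uniq ltn_trans ltnn _ J_sorted.
by rewrite i_last -eqSS (ltn_predK lt_i).
Qed.

Lemma rise_imageP v :
  (exists2 t, 0 < t <= n & rise I J t = v) <-> v.+1 \in I.
Proof.
split=> [[t /andP[t0 le_tn] <-]|vI].
  have := mem_nth 0 (count_J_lt le_tn); rewrite /rise => inI.
  by rewrite prednK //; case/andP: (I_in inI).
pose k := index v.+1 I; have lt_k : k < size J by rewrite -eq_size index_mem.
exists (nth 0 J k); first exact/J_in/mem_nth.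
by rewrite rise_at_J // nth_index.
Qed.

Local Notation path := (lattice_word n (rise I J)).

Lemma peaks_rise p : reflect
  (exists2 k, k < size J & p = nth 0 I k + nth 0 J k - 1) (p \in peaks path).
Proof.
have peak_J k : k < size J ->
    nth 0 I k + nth 0 J k - 1 = nth 0 J k + rise I J (nth 0 J k).
  move=> lt_k; rewrite rise_at_J //; have : nth 0 I k \in I.
    by rewrite mem_nth ?eq_size.
  by move=> /I_in; case: (nth 0 I k) => // i _; rewrite addSn subn1 addnC.
apply: (iffP (peaks_lattice_word rise_mono rise_lt p)).
  move=> [t [t0 le_tn ct ->]]; have tJ : t \in J.
    move: le_tn; rewrite leq_eqVlt => /predU1P[->//|lt_tn].
    by rewrite -rise_jump ?ct.
  have lt_k : index t J < size J by rewrite index_mem.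
  by exists (index t J); rewrite ?peak_J // nth_index.
move=> [k lt_k ->]; have /andP[k0 le_k] := J_in (mem_nth 0 lt_k).
exists (nth 0 J k); rewrite peak_J //; split=> // lt_n.
by rewrite rise_jump ?mem_nth.
Qed.

Lemma valleys_rise p : reflect
  (exists2 k, k.+1 < size J & p = nth 0 I k.+1 + nth 0 J k - 1)
  (p \in valleys path).
Proof.
have valley_J k : k.+1 < size J ->
    nth 0 I k.+1 + nth 0 J k - 1 = nth 0 J k + rise I J (nth 0 J k).+1.
  move=> lt_k; rewrite rise_after_J ?(ltnW lt_k) //; have : nth 0 I k.+1 \in I.
    by rewrite mem_nth ?eq_size.
  by move=> /I_in; case: (nth 0 I k.+1) => // i _; rewrite addSn subn1 addnC.
apply: (iffP (valleys_lattice_word rise_mono rise_lt p)).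
  move=> [t [t0 lt_tn ct ->]]; have tJ : t \in J by rewrite -rise_jump.
  have lt_k : index t J < size J by rewrite index_mem.
  have lt_k1 : (index t J).+1 < size J.
    by rewrite ltn_neqAle lt_k -last_J // nth_index // (ltn_eqF lt_tn).
  by exists (index t J); rewrite ?valley_J // nth_index.
move=> [k lt_k ->]; have /andP[k0 le_k] := J_in (mem_nth 0 (ltnW lt_k)).
have lt_n : nth 0 J k < n.
  by rewrite ltn_neqAle (last_J (ltnW lt_k)) (ltn_eqF lt_k).
exists (nth 0 J k); rewrite valley_J //; split=> //.
by rewrite rise_jump ?mem_nth // ltnW.
Qed.

End Rise.

(** * Minima and maxima of the blocks of a partition *)

Section BlockSums.
Variable n : nat.
Implicit Types (B : {set 'I_n}) (pi : {set {set 'I_n}}).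

Lemma elems_sorted B : sorted ltn (elems B).
Proof.
rewrite /elems sorted_map {1}/enum_mem; apply: sorted_filter.
  by move=> x y z; apply: ltn_trans.
have : sorted ltn [seq val x | x <- enum 'I_n].
  by rewrite val_enum_ord iota_ltn_sorted.
by rewrite sorted_map enumT.
Qed.

Lemma mem_elems B (x : 'I_n) : (x.+1 \in elems B) = (x \in B).
Proof.
apply/mapP/idP => [[y]|xB]; last by exists x; rewrite ?mem_enum.
by rewrite mem_enum => yB [] /val_inj->.
Qed.

Lemma elemsP B k :
  reflect (exists2 x : 'I_n, x \in B & k = x.+1) (k \in elems B).
Proof.
apply: (iffP mapP) => -[x xB ->]; exists x; rewrite ?mem_enum // in xB *.
Qed.

Lemma size_elems B : size (elems B) = #|B|.
Proof. by rewrite size_map cardE. Qed.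

Lemma elems_cons B : B != set0 ->
  elems B = block_min B :: behead (elems B).
Proof.
move=> B0; have : 0 < size (elems B) by rewrite size_elems card_gt0.
by rewrite /block_min; case: (elems B).
Qed.

Lemma block_min_mem B : B != set0 -> block_min B \in elems B.
Proof. by move=> /elems_cons->; rewrite mem_head. Qed.

Lemma block_max_mem B : B != set0 -> block_max B \in elems B.
Proof. by move=> /elems_cons eB; rewrite /block_max eB /= mem_last. Qed.

Lemma block_min_le B x : x \in B -> block_min B <= x.+1.
Proof.
rewrite -mem_elems /block_min; have := elems_sorted B.
case: (elems B) => //= k s; rewrite (path_sortedE ltn_trans) => /andP[/allP lt_k _].
by rewrite inE => /predU1P[->//|/lt_k/ltnW].
Qed.

Lemma block_max_ge B x : x \in B -> x < block_max B.
Proof.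
rewrite -mem_elems /block_max; have := elems_sorted B.
case: (lastP (elems B)) => //= s k; rewrite last_rcons.
rewrite -(rev_sorted _ (rcons _ _)) rev_rcons /=.
rewrite path_sortedE; last by move=> a b c ab bc; apply: ltn_trans bc ab.
move=> /andP[/allP lt_k _].
by rewrite mem_rcons inE => /predU1P[->//|]; rewrite -mem_rev => /lt_k/ltnW.
Qed.

(** The weight counts every element twice except the two extreme ones; in this
    form a singleton block, whose only element is both extremes, obeys the same
    formula as the others. *)
Lemma wt_sum B : B != set0 ->
  wt B + block_min B + block_max B + #|B| = 2 * (\sum_(x in B) x.+1) + 1.
Proof.
move=> B0.
have -> : \sum_(x in B) x.+1 = \sum_(k <- elems B) k.
  by rewrite big_map big_enum.
have card_le : #|B| <= block_max B.
  rewrite -size_elems -[leqRHS](size_iota 1) uniq_leq_size //.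
    exact: sorted_uniq ltn_trans ltnn _ (elems_sorted B).
  move=> k /elemsP[x xB ->]; rewrite mem_iota add1n /= ltnS.
  exact: block_max_ge.
rewrite /wt -size_elems; move: card_le; rewrite -size_elems.
have : 0 < size (elems B) by rewrite size_elems card_gt0.
rewrite /block_min /block_max; case: (elems B) => // x s _ /=.
case: (lastP s) => [|m y] /=; first by rewrite big_seq1 /=; lia.
rewrite last_rcons size_rcons /= => le_y.
have -> : at1 (x :: rcons m y) (size m).+2 = y.
  by rewrite /at1 /= nth_rcons ltnn eqxx.
have -> : \sum_(2 <= k < (size m).+2) at1 (x :: rcons m y) k = \sum_(k <- m) k.
  rewrite (big_addn 0 _ 2) subn2 [RHS](big_nth 0) /=.
  apply: eq_big_nat => k lt_k; rewrite /at1 addn2 /= nth_rcons.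
  by case: ltnP lt_k.
by rewrite big_cons -cats1 big_cat big_seq1 /at1 /=; lia.
Qed.

Lemma perm_minima pi : perm_eq (minima pi) [seq block_min B | B <- enum pi].
Proof. by rewrite perm_sort. Qed.

Lemma perm_maxima pi : perm_eq (maxima pi) [seq block_max B | B <- enum pi].
Proof. by rewrite perm_sort. Qed.

Variable pi : {set {set 'I_n}}.
Hypothesis part_pi : partition pi [set: 'I_n].

Lemma block_neq0 B : B \in pi -> B != set0.
Proof. by case/and3P: part_pi => _ _ n0 Bpi; apply: contraNneq n0 => <-. Qed.

Lemma block_of (x : 'I_n) : exists2 B, B \in pi & x \in B.
Proof.
case/and3P: part_pi => /eqP cov _ _.
have : x \in cover pi by rewrite cov inE.
by case/bigcupP => B Bpi xB; exists B.
Qed.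

Lemma block_eq B C (x : 'I_n) :
  B \in pi -> C \in pi -> x \in B -> x \in C -> B = C.
Proof.
case/and3P: part_pi => _ triv _ Bpi Cpi xB xC.
by rewrite -(def_pblock triv Bpi xB) (def_pblock triv Cpi xC).
Qed.

(** Distinct blocks are disjoint, so an element of a block determines it. *)
Lemma uniq_block_stat (f : {set 'I_n} -> nat) :
  {in pi, forall B, f B \in elems B} -> uniq [seq f B | B <- enum pi].
Proof.
move=> f_in; rewrite map_inj_in_uniq ?enum_uniq // => B C.
rewrite !mem_enum => Bpi Cpi eq_f.
have /elemsP[x xB ex] := f_in B Bpi; have /elemsP[y yC ey] := f_in C Cpi.
apply: block_eq Bpi Cpi xB _; suff -> : x = y by [].
by apply: val_inj; move: eq_f; rewrite ex ey => -[].
Qed.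

Lemma sort_uniq_ltn (s : seq nat) : uniq s -> sorted ltn (sort leq s).
Proof.
by move=> us; rewrite ltn_sorted_uniq_leq sort_uniq us sort_sorted.
Qed.

Lemma minima_sorted : sorted ltn (minima pi).
Proof. by apply/sort_uniq_ltn/uniq_block_stat => B /block_neq0/block_min_mem. Qed.

Lemma maxima_sorted : sorted ltn (maxima pi).
Proof. by apply/sort_uniq_ltn/uniq_block_stat => B /block_neq0/block_max_mem. Qed.

Lemma size_minima : size (minima pi) = #|pi|.
Proof. by rewrite (perm_size (perm_minima pi)) size_map cardE. Qed.

Lemma size_maxima : size (maxima pi) = #|pi|.
Proof. by rewrite (perm_size (perm_maxima pi)) size_map cardE. Qed.

Lemma minimaP k :
  reflect (exists2 B, B \in pi & k = block_min B) (k \in minima pi).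
Proof.
rewrite (perm_mem (perm_minima pi)).
by apply: (iffP mapP) => -[B Bpi ->]; exists B; rewrite ?mem_enum // in Bpi *.
Qed.

Lemma maximaP k :
  reflect (exists2 B, B \in pi & k = block_max B) (k \in maxima pi).
Proof.
rewrite (perm_mem (perm_maxima pi)).
by apply: (iffP mapP) => -[B Bpi ->]; exists B; rewrite ?mem_enum // in Bpi *.
Qed.

Lemma elems_range B k : k \in elems B -> 0 < k <= n.
Proof. by case/elemsP => x _ ->; apply: ltn_ord. Qed.

Lemma minima_range : {in minima pi, forall i, 0 < i <= n}.
Proof.
move=> i /minimaP[B /block_neq0/block_min_mem iB ->].
exact: elems_range iB.
Qed.

Lemma maxima_range : {in maxima pi, forall i, 0 < i <= n}.
Proof.
move=> i /maximaP[B /block_neq0/block_max_mem iB ->].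
exact: elems_range iB.
Qed.

Lemma n_in_maxima : 0 < n -> n \in maxima pi.
Proof.
move=> n_gt0; have lt_n : n.-1 < n by lia.
have [B Bpi nB] := block_of (Ordinal lt_n); apply/maximaP; exists B => //.
have := block_max_ge nB; have /elems_range := block_max_mem (block_neq0 Bpi).
by rewrite /=; lia.
Qed.

(** A block with maximum below t has minimum at most t, and the block of t
    itself is one more with minimum at most t. *)
Lemma ballot_blocks t : 0 < t -> t <= n ->
  count (fun j => j < t) (maxima pi) < count (fun i => i <= t) (minima pi).
Proof.
move=> t0 le_tn; have lt_t : t.-1 < n by lia.
have [B Bpi tB] := block_of (Ordinal lt_t).
have t_min := block_min_le tB; have t_max := block_max_ge tB.
rewrite /= prednK // in t_min t_max.
have count_enum (p : pred {set 'I_n}) :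
    count p (enum pi) = #|[set C in pi | p C]|.
  rewrite -size_filter cardE; apply/perm_size/uniq_perm.
  - exact/filter_uniq/enum_uniq.
  - exact: enum_uniq.
  by move=> C; rewrite mem_filter !mem_enum !inE andbC.
rewrite (seq.permP (perm_maxima pi)) (seq.permP (perm_minima pi)).
rewrite !count_map !count_enum.
apply: proper_card; apply/properP; split.
  apply/subsetP => C; rewrite !inE => /andP[Cpi lt_max]; rewrite Cpi /=.
  have /elemsP[x xC ex] := block_min_mem (block_neq0 Cpi).
  by have := block_max_ge xC; lia.
by exists B; rewrite !inE Bpi //= -leqNgt; lia.
Qed.

Lemma maj_part_sum : maj_part pi + sumn (minima pi) + sumn (maxima pi) + n =
  2 * (\sum_(x < n) x.+1) + #|pi|.
Proof.
rewrite !sumnE (perm_big _ (perm_minima pi)) (perm_big _ (perm_maxima pi)) /=.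
rewrite !big_map !big_enum /= -[X in _ + X = _](card_ord n) -cardsT.
rewrite (card_partition part_pi) /maj_part -!big_split /=.
rewrite (eq_bigr _ (fun B Bpi => wt_sum (block_neq0 Bpi))) big_split /=.
rewrite -big_distrr /= sum1_card -(set_partition_big _ part_pi) /=.
by rewrite (eq_bigl _ _ (@in_setT _)).
Qed.

Lemma maj_part_eq : maj_part pi + sumn (minima pi) + sumn (maxima pi) =
  2 * (\sum_(0 <= j < n) j) + n + #|pi|.
Proof.
rewrite -[LHS](addnK n) maj_part_sum.
have -> : \sum_(x < n) x.+1 = \sum_(x < n) x + \sum_(x < n) 1.
  by rewrite -big_split; apply: eq_bigr => x _; rewrite /= addn1.
by rewrite sum1_card card_ord big_mkord; lia.
Qed.

End BlockSums.

(** * The path and the code attached to a partition *)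

Section DyckPath.
Variables (n : nat) (pi : {set {set 'I_n}}).
Hypothesis (n_gt0 : 0 < n) (part_pi : partition pi [set: 'I_n]).
Local Notation c := (rise (minima pi) (maxima pi)).

Let size_stat : size (minima pi) = size (maxima pi).
Proof. by rewrite size_minima size_maxima. Qed.

Lemma rise_pi_mono s t : 0 < s -> s <= t -> t <= n -> c s <= c t.
Proof.
exact: rise_mono (minima_sorted part_pi) size_stat
  (n_in_maxima part_pi n_gt0) _ _.
Qed.

Lemma rise_pi_lt t : 0 < t -> t <= n -> c t < t.
Proof.
exact: rise_lt (minima_sorted part_pi) (ballot_blocks part_pi) _.
Qed.

Lemma same_setP (s t : seq nat) : reflect (s =i t) (same_set s t).
Proof.
apply: (iffP andP) => [[/allP st /allP ts] x|st].
  by apply/idP/idP => [/st|/ts].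
by split; apply/allP => x; rewrite st.
Qed.

Lemma is_dyck_of_lattice_word : is_dyck_of pi (lattice_word n c).
Proof.
have I_sorted := minima_sorted part_pi; have J_sorted := maxima_sorted part_pi.
have I_in := minima_range part_pi; have J_in := maxima_range part_pi.
have nJ := n_in_maxima part_pi n_gt0; have ballot := ballot_blocks part_pi.
apply/and3P; split; first exact: is_dyck_lattice_word rise_pi_mono rise_pi_lt.
  apply/same_setP => p.
  apply/(peaks_rise I_sorted J_sorted size_stat I_in J_in nJ ballot)/mapP.
    rewrite size_maxima => -[k lt_k ->].
    by exists k.+1; rewrite ?mem_iota //; lia.
  move=> [[|k]]; rewrite ?mem_iota // add1n ltnS => lt_k ->.
  by exists k; rewrite ?size_maxima.
apply/same_setP => p.
apply/(valleys_rise I_sorted J_sorted size_stat I_in J_in nJ ballot)/mapP.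
  by rewrite size_maxima => -[k lt_k ->]; exists k.+1; rewrite ?mem_iota //; lia.
move=> [[|k]]; rewrite ?mem_iota // => lt_k ->.
by exists k; rewrite ?size_maxima //; lia.
Qed.

Lemma dyck_starts_up d : size d = n.*2 -> is_dyck n d -> letter d 1 = false.
Proof.
case: d => [|b d] //= sd /and3P[_ _ /allP/(_ 1)].
by rewrite mem_iota /= take0 /letter /=; case: b => // /(_ isT).
Qed.

(** Any word with the prescribed peaks and valleys agrees with the explicit one
    by [word_of_turns], as a Dyck path starts with an up step. *)
Lemma dyck_of_pi : dyck_of pi = lattice_word n c.
Proof.
have size_w : size (lattice_word n c) == n.*2 by rewrite size_lattice_word.
have w_ok := is_dyck_of_lattice_word.
rewrite /dyck_of; case: pickP => [d d_ok|/(_ (Tuple size_w))]; last first.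
  by rewrite /= w_ok.
move: d_ok w_ok => /and3P[d_dyck /same_setP dP /same_setP dV].
move=> /and3P[w_dyck /same_setP wP /same_setP wV].
apply: word_of_turns => [|||].
- by rewrite size_tuple (eqP size_w).
- by rewrite !dyck_starts_up ?size_tuple ?(eqP size_w).
- by move=> p; rewrite dP wP.
- by move=> p; rewrite dV wV.
Qed.

(** With i counted from 0 the entry is a_(i+1) = c (n - i); the existence of a
    permutation with this code uses c t < t at t = n - i. *)
Lemma lehmer_mu_of (i : 'I_n) : lehmer (mu_of pi) i = c (n - i).
Proof.
have code_i (j : nat) : j < n ->
    code_of_path n (dyck_of pi) j.+1 = c (n - j).
  move=> lt_jn; rewrite dyck_of_pi (code_of_lattice_word rise_pi_mono rise_pi_lt) //.
  by congr (rise _ _ _); lia.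
rewrite /mu_of /perm_of_code; case: pickP => [mu /forallP mu_code|no_mu].
  by rewrite (eqP (mu_code i)) code_i.
have [|mu mu_code] := @lehmer_surj n (fun j => c (n - j)).
  by move=> j lt_jn; have := @rise_pi_lt (n - j); lia.
have /forallP[] := negbT (no_mu mu) => j.
by rewrite mu_code code_i.
Qed.

End DyckPath.

(** * Descents of sigma and of its inverse *)

Lemma maj_permE n (s : {perm 'I_n}) (P : pred nat) :
  (forall u v : 'I_n, v = u.+1 :> nat -> (s v < s u) = P v) ->
  maj_perm s = \sum_(1 <= j < n | P j) j.
Proof.
have at1_word (x : 'I_n) : at1 (word s) x.+1 = (s x).+1.
  by rewrite /at1 /word /= (nth_map x) ?size_enum_ord // nth_ord_enum.
move=> desP; rewrite /maj_perm big_nat_cond [RHS]big_nat_cond.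
apply: eq_bigl => j; apply: andb_id2l => /andP[j0 lt_jn].
have lt_un : j.-1 < n by lia.
have := at1_word (Ordinal lt_un); have := at1_word (Ordinal lt_jn).
rewrite /= prednK // => -> ->; rewrite ltnS.
by apply: desP; rewrite /= prednK.
Qed.

Lemma sum_complement n (S : seq nat) (f : nat -> nat) : uniq S ->
  {in S, forall i, 0 < i <= n} ->
  \sum_(1 <= j < n.+1 | j \notin S) f j + \sum_(j <- S) f j =
  \sum_(1 <= j < n.+1) f j.
Proof.
move=> uniqS S_in; rewrite addnC [RHS](bigID (mem S)) /=; congr (_ + _).
rewrite -[RHS]big_filter.
apply/perm_big/uniq_perm; rewrite ?filter_uniq ?iota_uniq //.
move=> j; rewrite mem_filter mem_index_iota.
by case: (boolP (j \in S)) => // /S_in; lia.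
Qed.

Section MajorIndices.
Variables (n : nat) (pi : {set {set 'I_n}}).
Hypothesis (n_gt0 : 0 < n) (part_pi : partition pi [set: 'I_n]).
Local Notation I := (minima pi).
Local Notation J := (maxima pi).
Local Notation mu := (mu_of pi).

Lemma lehmer_mu_mono (i j : 'I_n) : i <= j -> lehmer mu j <= lehmer mu i.
Proof.
move=> le_ij; rewrite !lehmer_mu_of //.
by apply: rise_pi_mono => //; have := ltn_ord j; lia.
Qed.

(** Complementing the values exchanges descents and ascents, and the descents
    of the inverse of mu are the values i_k - 1 > 0 of its code. *)
Lemma maj_sigma :
  maj_perm (sigma_of pi) = \sum_(1 <= j < n | j.+1 \notin I) j.
Proof.
apply: (@maj_permE _ _ (fun j => j.+1 \notin I)) => u v vu.
have -> : (sigma_of pi v < sigma_of pi u) = ~~ (mu^-1%g v < mu^-1%g u).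
  rewrite /sigma_of /bar !permM !(permE (@rev_ord_inj n)) /= -leqNgt.
  have neq : (mu^-1%g u : nat) <> mu^-1%g v.
    by move=> /val_inj/perm_inj uv; move: vu; rewrite uv; lia.
  by have := ltn_ord (mu^-1%g u); have := ltn_ord (mu^-1%g v); lia.
congr (~~ _); rewrite (descents_inv_decreasing_code lehmer_mu_mono vu).
have imP := rise_imageP (maxima_sorted part_pi)
  (etrans (size_minima pi) (esym (size_maxima pi)))
  (minima_range part_pi) (maxima_range part_pi) (n_in_maxima part_pi n_gt0) v.
apply/existsP/idP => [[i /eqP code_i]|/imP[t t_in <-]].
  apply/imP; rewrite -code_i; exists (n - i); last by rewrite lehmer_mu_of.
  by have := ltn_ord i; lia.
have lt_i : n - t < n by lia.
exists (Ordinal lt_i); rewrite lehmer_mu_of //=.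
by rewrite subKn //; case/andP: t_in.
Qed.

(** The inverse of sigma is mu read backwards, so its descents at j come from
    the ascents of mu at n - j, where the code does not drop. *)
Lemma maj_sigma_inv :
  maj_perm (sigma_of pi)^-1%g = \sum_(1 <= j < n | j \notin J) j.
Proof.
have invE (u : 'I_n) : (sigma_of pi)^-1%g u = mu (rev_ord u).
  apply: (@perm_inj _ (sigma_of pi)).
  by rewrite permKV /sigma_of /bar permM permK permE rev_ordK.
apply: (@maj_permE _ _ (fun j => j \notin J)) => u v vu; rewrite !invE.
have rev_vu : rev_ord u = (rev_ord v).+1 :> nat.
  by rewrite /=; have := ltn_ord v; lia.
have neq : (mu (rev_ord u) : nat) <> mu (rev_ord v).
  by move=> /val_inj/perm_inj/rev_ord_inj uv; move: vu; rewrite uv; lia.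
have -> : (mu (rev_ord v) < mu (rev_ord u)) =
          ~~ (mu (rev_ord u) < mu (rev_ord v)) by lia.
congr (~~ _); rewrite -(lehmer_drop mu rev_vu) !lehmer_mu_of //=.
have lt_v := ltn_ord v; have v_gt0 : 0 < v by lia.
rewrite -vu (subKn lt_v) (subKn (ltnW lt_v)); apply: rise_jump => //.
- exact: minima_sorted.
- exact: maxima_sorted.
- by rewrite size_minima size_maxima.
- exact: minima_range.
- exact: n_in_maxima.
Qed.

Lemma maj_sigma_sum : maj_perm (sigma_of pi) + sumn I =
  \sum_(0 <= j < n) j + #|pi|.
Proof.
have uniqI := sorted_uniq ltn_trans ltnn (minima_sorted part_pi).
have := sum_complement predn uniqI (minima_range part_pi).
have -> : \sum_(1 <= j < n.+1) j.-1 = \sum_(0 <= j < n) j by rewrite big_add1.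
have -> : \sum_(1 <= j < n.+1 | j \notin I) j.-1 = maj_perm (sigma_of pi).
  rewrite maj_sigma big_add1 /= big_mkcond big_ltn //= if_same add0n.
  by rewrite -big_mkcond.
move=> <-; rewrite -addnA; congr (_ + _).
rewrite sumnE -(size_minima pi) -sum1_size -big_split /= big_seq [RHS]big_seq.
by apply: eq_bigr => i /(minima_range part_pi); lia.
Qed.

Lemma maj_sigma_inv_sum : maj_perm (sigma_of pi)^-1%g + sumn J =
  \sum_(0 <= j < n) j + n.
Proof.
have uniqJ := sorted_uniq ltn_trans ltnn (maxima_sorted part_pi).
have := sum_complement id uniqJ (maxima_range part_pi).
have -> : \sum_(1 <= j < n.+1) j = \sum_(0 <= j < n) j + n.
  by rewrite -big_nat_recr //= [RHS]big_ltn.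
have -> : \sum_(1 <= j < n.+1 | j \notin J) j = maj_perm (sigma_of pi)^-1%g.
  rewrite maj_sigma_inv big_mkcond big_nat_recr //= n_in_maxima // addn0.
  by rewrite -big_mkcond.
by rewrite sumnE.
Qed.

End MajorIndices.

Theorem theorem4p14 (n : nat) (pi : {set {set 'I_n}})
  (hn : 1 <= n) (hpi : is_NC pi) :
  maj_part pi = maj_perm (sigma_of pi) + maj_perm (sigma_of pi)^-1%g.
Proof.
case: hpi => part_pi _.
have := maj_part_eq part_pi; have := maj_sigma_sum hn part_pi.
have := maj_sigma_inv_sum hn part_pi.
lia.
Qed.
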